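(* Equip $\mathbb{Z}^3$ with the $d_1$ (Manhattan) metric. Then for each real $r \geq 3$, the Rips complex $\mathrm{Rips}(\mathbb{Z}^3, r)$ is contractible.
   Context: The $d_1$ metric on $\mathbb{R}^3$ (restricted to $\mathbb{Z}^3$) is $d_1((a_1,a_2,a_3),(b_1,b_2,b_3)) = \sum_{i=1}^3 |a_i-b_i|$. For a metric space $(X,d)$ and $r\ge 0$, the (closed) Rips complex $\mathrm{Rips}(X,r)$ is the abstract simplicial complex with vertex set $X$ in which a nonempty finite subset $\sigma\subseteq X$ is a simplex if and only if $\mathrm{Diam}(\sigma)=\max_{x,y\in\sigma} d(x,y)\le r$. Contractibility of an abstract simplicial complex means contractibility of its geometric realization. *)

(* Defs.v *)
From HB Require Import structures.
From mathcomp Require Import all_boot all_order all_algebra.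
From mathcomp Require Import finmap.
From mathcomp Require Import all_classical all_reals all_analysis.
Set Implicit Arguments.
Unset Strict Implicit.
Unset Printing Implicit Defensive.
Import Order.TTheory GRing.Theory Num.Theory.
Import numFieldNormedType.Exports.
Local Open Scope classical_set_scope.
Local Open Scope ring_scope.

(* The vertices of a complex over V are the v such that [fset v] is a
   simplex; they need not exhaust V (see [rips_vertex] for Rips complexes). *)
Record simplicial_complex (V : choiceType) := SimplicialComplex {
  simplices : set {fset V};
  simplex_neq0 : forall s, simplices s -> s != fset0;
  simplex_face : forall s t, simplices s -> t != fset0 -> (t `<=` s)%fset ->
    simplices t
}.

Section realization.
Context (R : realType) (V : choiceType) (K : simplicial_complex V).

(* Points are given by their barycentric coordinates. *)
Definition is_bary (t : {fsfun V -> R with 0}) : Prop :=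
  [/\ simplices K (finsupp t), forall v, 0 <= t v
    & \sum_(v <- finsupp t) t v = 1].

Definition realization : Type := {t : {fsfun V -> R with 0} | `[< is_bary t >]}.

HB.instance Definition _ := Choice.on realization.

Definition bary (p : realization) : V -> R := fun v => val p v.

Definition closed_simplex (s : {fset V}) : set realization :=
  [set p | (finsupp (val p) `<=` s)%fset].

(* Pointwise convergence of barycentric coordinates induces the Euclidean
   topology on each closed simplex, since only the finitely many coordinates
   in s may be nonzero there (see [open_closed_simplexP]). *)
Definition ptws_realization : Type :=
  initial_topology (bary : realization -> prod_topology (fun _ : V => R)).

HB.instance Definition _ := Topological.on ptws_realization.

(* The coherent (weak) topology: U is open iff its trace on every closed
   simplex is open in that simplex. *)
Definition realization_open (U : set realization) : Prop :=
  forall s, simplices K s ->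
    open (U : set (subspace (closed_simplex s : set ptws_realization))).

Lemma realization_openT : realization_open setT.
Proof. by move=> s _; exact: openT. Qed.

Lemma realization_openI : setI_closed realization_open.
Proof. by move=> A B oA oB s Ks; apply: openI; [exact: oA|exact: oB]. Qed.

Lemma realization_open_bigU (I : Type) (f : I -> set realization) :
  (forall i, realization_open (f i)) -> realization_open (\bigcup_i f i).
Proof. by move=> of_ s Ks; apply: bigcup_open => i _; exact: of_. Qed.

HB.instance Definition _ := isOpenTopological.Build realization
  realization_openT realization_openI realization_open_bigU.

Lemma open_closed_simplexP (s : {fset V}) (U : set realization) :
  open (U : set (subspace (closed_simplex s : set ptws_realization))) <->
  forall p, closed_simplex s p -> U p ->
    exists2 e : R, 0 < e & forall q, closed_simplex s q ->
      (forall v, `|bary p v - bary q v| < e) -> U q.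
Proof.
split.
  move=> /open_subspaceP[_ [W oW <-] WU] p sp Up.
  have Wp : W (bary p) by have [] : (bary @^-1` W `&` closed_simplex s) p
    by rewrite WU.
  pose B (e : R) := [set q | closed_simplex s q /\
    forall v, `|bary p v - bary q v| < e].
  pose F := filter_from [set e : R | 0 < e] B.
  have FF : Filter F.
    apply: filter_from_filter; first by exists 1 => /=.
    move=> e1 e2 /= e10 e20; exists (Num.min e1 e2).
      by rewrite /= lt_min e10.
    move=> q [sq pq]; split; split=> // v;
      by move: (pq v); rewrite lt_min => /andP[].
  have : nbhs (bary @ F) W.
    have /(_ W) : bary @ F --> (bary p : prod_topology (fun _ : V => R)).
      apply/cvg_sup => v A [_] [[G oG <-] Gp] GA; apply: filterS GA _.
      have /nbhs_ballP[e /= e0 eG] : nbhs (bary p v) G by exact: open_nbhs_nbhs.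
      by exists e => // q [_ pq]; exact/eG/pq.
    by apply; exact: open_nbhs_nbhs.
  move=> [e e0 BW]; exists e => // q sq pq.
  by have [] : (U `&` closed_simplex s) q by rewrite -WU; split=> //; exact: BW.
move=> UB; rewrite -open_subspaceIT openE => p [Up sp].
have [e e0 eU] := UB _ sp Up.
rewrite /interior/= /nbhs/= -nbhs_subspace_in//.
have : nbhs (p : ptws_realization)
  (\bigcap_(v in [set` s]) [set q | `|bary p v - bary q v| < e]).
  apply: filter_bigI => v vs.
  have cv : continuous
      ((fun f : prod_topology (fun _ : V => R) => f v) \o
       (bary : ptws_realization -> prod_topology (fun _ : V => R))).
    move=> q; apply: continuous_comp; first exact: initial_continuous.
    exact: (@proj_continuous V (fun _ : V => R) v).
  by have := cv p; move=> /cvgrPdist_lt /(_ _ e0).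
apply: filterS => q pq sq; split=> //; apply: eU => // v.
have [vs|vs] := boolP (v \in s); first exact: pq.
have s0 (t : realization) : closed_simplex s t -> bary t v = 0.
  by move=> /fsubsetP st; apply: fsfun_dflt; exact: contra (st v) vs.
by rewrite !s0// subrr normr0.
Qed.

End realization.

Definition homotopic (R : realType) (X Y : topologicalType) (f g : X -> Y) :
    Prop :=
  exists H : X * R -> Y,
    [/\ {within [set: X] `*` `[0, 1], continuous H},
        forall x, H (x, 0) = f x & forall x, H (x, 1) = g x].

Definition contractible (R : realType) (X : topologicalType) : Prop :=
  exists x0 : X, homotopic R (@idfun X) (cst x0).

Section rips.
Context (R : realType) (X : metricType R).

Definition diam (s : {fset X}) : R :=
  \big[Num.max/0]_(x <- s) \big[Num.max/0]_(y <- s) mdist x y.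

Lemma diam_leP (s : {fset X}) (r : R) : 0 <= r ->
  diam s <= r <-> (forall x y, x \in s -> y \in s -> mdist x y <= r).
Proof.
move=> r0; split=> [sr x y xs ys|sr].
  apply: le_trans sr; rewrite /diam; apply: (@bigmax_sup_seq _ _ _ _ _ x) => //.
  exact: (@bigmax_sup_seq _ _ _ _ _ y).
by rewrite /diam big_seq; apply: bigmax_le => // x xs; rewrite big_seq;
  apply: bigmax_le => // y ys; exact: sr.
Qed.

Lemma diamS (s t : {fset X}) : (t `<=` s)%fset -> diam t <= diam s.
Proof.
move=> /fsubsetP ts; apply/diam_leP; first exact: bigmax_ge_id.
move=> x y /ts xs /ts ys.
by have /diam_leP := lexx (diam s); apply => //; exact: bigmax_ge_id.
Qed.

Definition rips_simplices (r : R) : set {fset X} :=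
  [set s | s != fset0 /\ diam s <= r].

Lemma rips_neq0 r s : rips_simplices r s -> s != fset0.
Proof. by case. Qed.

Lemma rips_face r s t : rips_simplices r s -> t != fset0 -> (t `<=` s)%fset ->
  rips_simplices r t.
Proof. by move=> [_ sr] t0 ts; split=> //; exact: le_trans (diamS ts) sr. Qed.

Definition Rips (r : R) : simplicial_complex X :=
  SimplicialComplex (@rips_neq0 r) (@rips_face r).

Lemma rips_vertex (r : R) (x : X) : 0 <= r -> simplices (Rips r) [fset x]%fset.
Proof.
move=> r0; split; first by apply/fset0Pn; exists x; rewrite inE.
apply/diam_leP => // y z /fset1P-> /fset1P->; by rewrite mdistxx.
Qed.

End rips.
Arguments Rips {R} X r.

Definition d1 (R : realType) (n : nat) (a b : 'rV[R]_n) : R :=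
  \sum_(i < n) `|a 0 i - b 0 i|.

(* Z^n with the restriction of d1, as a metric space of its own. *)
Definition Zd1 (R : realType) (n : nat) : Type := 'rV[int]_n.

Section Zd1_metric.
Context (R : realType) (n : nat).
Local Notation T := (Zd1 R n).

Definition Zd1_dist (a b : T) : R :=
  d1 (map_mx (intr : int -> R) a) (map_mx (intr : int -> R) b).

Lemma Zd1_distxx a : Zd1_dist a a = 0.
Proof. by rewrite /Zd1_dist /d1 big1// => i _; rewrite subrr normr0. Qed.

Lemma Zd1_dist_eq0 a b : Zd1_dist a b = 0 -> a = b.
Proof.
move=> /eqP; rewrite psumr_eq0// => /allP ab; apply/rowP => i.
have := ab i (mem_index_enum i); rewrite !mxE/= normr_eq0 subr_eq0.
by move/eqP/intr_inj.
Qed.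

Lemma Zd1_dist_sym a b : Zd1_dist a b = Zd1_dist b a.
Proof. by apply: eq_bigr => i _; rewrite distrC. Qed.

Lemma Zd1_dist_triangle b a c : Zd1_dist a c <= Zd1_dist a b + Zd1_dist b c.
Proof. by rewrite -big_split/=; apply: ler_sum => i _; exact: ler_distD. Qed.

HB.instance Definition _ := Choice.copy T 'rV[int]_n.
HB.instance Definition _ := @isMetric.Build R T Zd1_dist
  Zd1_distxx Zd1_dist_eq0 Zd1_dist_sym Zd1_dist_triangle.

Lemma mdist_Zd1 (a b : T) : mdist a b = Zd1_dist a b.
Proof. by []. Qed.

End Zd1_metric.

(* Main.v *)
Require Import Defs.
From HB Require Import structures.
From mathcomp Require Import all_boot all_order all_algebra.
From mathcomp Require Import finmap zify ring lra.
From mathcomp Require Import all_classical all_reals all_analysis.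
Import Order.TTheory GRing.Theory Num.Theory.
Import numFieldNormedType.Exports.
Set Implicit Arguments.
Unset Strict Implicit.
Unset Printing Implicit Defensive.
Local Open Scope ring_scope.

(** The complex is emptied down to the vertex 0 by a sequence of elementary
    collapses, indexed by the natural numbers and carried out from large index
    to small index within one unit of time.

    Elementary collapse.  Let a be a face and w a vertex outside a such that
    every simplex s containing a stays a simplex when w is added.  A point with
    barycentric coordinates p can then lose the weight least a p, the minimum
    of p over a, at each vertex of a and regain all of it at w; the linear
    motion doing this ([push]) stays inside simplices and ends outside the open
    star of a.  Collapse number n is carried out during the times between
    1 / 2^(n+1) and 1 / 2^n.  A simplex contains only finitely many of the faces, so
    a point rests for a while, then undergoes its finitely many collapses, the
    last one at time 1.  In a locally finite complex the number of collapses
    involved is bounded near each point, and near each point the motion lives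
    in a finite subcomplex, where the coherent topology is that of the
    coordinates: the motion is continuous ([collapsible_contractible]).

    The lattice.  Let N be the integer part of r.  The points are ordered by a
    weight with this property: for each v, after naming the coordinates of v
    hi, mid and lo by decreasing size, the points u lighter than v are
    lexicographically inside v.  Either u_hi lies strictly inward of v_hi (on
    the side of 0), or u_hi = v_hi and u_mid lies strictly inward of v_mid, or
    these agree too and u_lo lies strictly inward of v_lo ([weight_lex]).
    When v is removed, only lighter points are left.  In coordinates centred
    at v and pointing inward, consider the point (1, 1, 0).  It is at distance
    at most N from each remaining neighbour of v: stepping inward in hi or mid
    gains 1 and the other step loses at most 1.  The exceptions are the points
    (0, 0, N) and (0, 0, N-1).  So the two edges from v to them are collapsed
    first, onto (1, 0, 1).  This apex works because a common neighbour
    (0, y, z) of v and (0, 0, d) with d >= N-1 either has z > 0, and the step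
    in lo gains 1, or satisfies |y| + |z| + d <= N, hence |y| + |z| <= 1, and
    is at distance at most 3 <= N from (1, 0, 1) ([edge_apex_close]); the
    common neighbours with hi coordinate different from 0 gain 1 in hi.  After
    that v itself is collapsed onto (1, 1, 0) ([vertex_apex_close]).  If a
    coordinate of v is 0, it admits no lighter points and no step inward; the
    apexes are adjusted accordingly. *)

(** * Pushing the weight of a face onto a vertex *)

Section push.
Context {R : realType} {V : choiceType}.
Implicit Types (p : {fsfun V -> R with 0}) (a : {fset V}) (w : V) (s : R).

(** Starting the minimum at 1 is harmless for barycentric coordinates, and makes
    [least] total and continuous without a case distinction. *)
Definition least (a : {fset V}) (f : V -> R) : R :=
  \big[Num.min/1]_(v <- a) f v.

Lemma least_ge0 a f : (forall v, 0 <= f v) -> 0 <= least a f.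
Proof.
move=> f0; rewrite /least; elim/big_ind: _ => // x y x0 y0.
by rewrite le_min x0.
Qed.

Lemma least_le a f v : v \in a -> least a f <= f v.
Proof. by move=> va; exact: ge_bigmin_seq. Qed.

Lemma least_attained a f : a != fset0 -> (forall v, f v <= 1) ->
  exists2 v, v \in a & f v = least a f.
Proof.
move=> /fset0Pn[u ua] f1.
suff [E|//] : least a f = 1 \/ exists2 v, v \in a & f v = least a f.
  exists u => //; apply/eqP; rewrite E eq_le f1 -E; exact: least_le.
rewrite /least; have : {subset enum_fset a <= a} by [].
elim: (enum_fset a) => [_|x l IH la]; first by left; rewrite big_nil.
rewrite big_cons.
have [] := IH; first by move=> y yl; apply: la; rewrite inE yl orbT.
  move=> ->; right; exists x; first by apply: la; rewrite inE eqxx.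
  by rewrite min_l.
move=> [v va fv]; right.
case: (leP (f x) (\big[Order.min/1]_(j <- l) f j)) => h.
  by exists x => //; apply: la; rewrite inE eqxx.
by exists v.
Qed.

Lemma least_eq0 a p : (forall v, 0 <= p v) -> ~~ (a `<=` finsupp p)%fset ->
  least a p = 0.
Proof.
move=> p0 /fsubsetPn[v va vp]; apply/eqP; rewrite eq_le least_ge0// andbT.
by have := @least_le a p v va; rewrite (fsfun_dflt vp).
Qed.

(** At the empty face [push] is the identity, so that a void entry in a
    sequence of collapses needs no separate treatment. *)
Definition push a w s p : {fsfun V -> R with 0} :=
  [fsfun v in (finsupp p `|` a `|` [fset w])%fset =>
     p v - s * least a p * (v \in a)%:R
         + s * least a p * #|` a|%:R * (v == w)%:R | 0].

Lemma pushE a w s p v : push a w s p v =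
  p v - s * least a p * (v \in a)%:R + s * least a p * #|` a|%:R * (v == w)%:R.
Proof.
rewrite fsfun_fun; case: ifPn => //.
rewrite !inE !negb_or -andbA => /and3P[vp va vw].
by rewrite fsfun_dflt// (negbTE va) (negbTE vw) !mulr0 subrr addr0.
Qed.

Lemma push_id a w s p : s * least a p = 0 -> push a w s p = p.
Proof.
by move=> sl; apply/fsfunP => v; rewrite pushE sl !mul0r subr0 addr0.
Qed.

Lemma push0 w s p : push fset0 w s p = p.
Proof.
by apply/fsfunP => v; rewrite pushE in_fset0 cardfs0 !mulr0 mul0r subr0 addr0.
Qed.

Lemma sum_finsupp p (S : {fset V}) : (finsupp p `<=` S)%fset ->
  \sum_(v <- finsupp p) p v = \sum_(v <- S) p v.
Proof.
by move=> pS; apply: big_fset_incl => // v _ /fsfun_dflt.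
Qed.

Lemma finsupp_push_sub a w s p :
  (finsupp (push a w s p) `<=` finsupp p `|` a `|` [fset w])%fset.
Proof. exact: finsupp_sub. Qed.

Lemma sum_push a w s p :
  \sum_(v <- finsupp (push a w s p)) push a w s p v = \sum_(v <- finsupp p) p v.
Proof.
rewrite (sum_finsupp (finsupp_push_sub _ _ _ _)).
set S := (_ `|` _)%fset.
rewrite (@sum_finsupp p S); last by rewrite /S -fsetUA fsubsetUl.
under eq_bigr do rewrite pushE.
rewrite !big_split/= sumrN -!mulr_sumr.
have sum_ind (b : {fset V}) : (b `<=` S)%fset ->
    \sum_(v <- S) (v \in b)%:R = #|` b|%:R :> R.
  move=> bS; rewrite -(big_fset_incl _ bS); last first.
    by move=> v _ /negbTE ->.
  rewrite card_fset_sum1 natr_sum big_seq [RHS]big_seq.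
  by apply: eq_bigr => v ->.
rewrite sum_ind; last by rewrite /S -fsetUA fsetUCA fsubsetUl.
under [X in _ + _ * X]eq_bigr do rewrite -in_fset1.
rewrite sum_ind ?fsubsetUr// cardfs1; ring.
Qed.

Section weights.
Context {a : {fset V}} {w : V} {s : R} {p : {fsfun V -> R with 0}}.
Hypotheses (s01 : 0 <= s <= 1) (p0 : forall v, 0 <= p v)
  (p1 : forall v, p v <= 1).

Lemma push_ge0 v : 0 <= push a w s p v.
Proof.
case/andP: s01 => s0 s1; rewrite pushE addr_ge0//.
  rewrite subr_ge0; case: (boolP (v \in a)) => va; last by rewrite mulr0.
  rewrite mulr1 (le_trans _ (@least_le a p v va))// ler_piMl// least_ge0//.
by rewrite !mulr_ge0// least_ge0.
Qed.

Lemma finsupp_push : (a `<=` finsupp p)%fset ->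
  (finsupp (push a w s p) `<=` w |` finsupp p)%fset.
Proof.
move=> /fsetUidPl ap; apply: fsubset_trans (finsupp_push_sub _ _ _ _) _.
by rewrite ap fsetUC.
Qed.

End weights.

(** The full push leaves the open star of a: the vertices where the minimum is
    attained lose all their weight, and w, being outside a, does not return it. *)
Lemma push1_eq0 a w p : a != fset0 -> w \notin a -> (forall v, p v <= 1) ->
  exists2 v, v \in a & push a w 1 p v = 0.
Proof.
move=> a0 wa p1; have [v va pv] := least_attained a0 p1.
exists v => //; rewrite pushE va -pv.
have -> : (v == w) = false by apply/negbTE; apply: contraNneq wa => <-.
by rewrite mulr0 addr0 mulr1 mul1r subrr.
Qed.

End push.

(** * Coordinates and the coherent topology *)

Section realization_topology.
Context {R : realType} {V : choiceType} {K : simplicial_complex V}.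
Implicit Types (p q : {fsfun V -> R with 0}) (a b : {fset V}).
Local Notation X := (realization R K).

Lemma bary_le1 p v : is_bary K p -> p v <= 1.
Proof.
move=> [_ p0 <-]; case: (boolP (v \in finsupp p)) => vp; last first.
  by rewrite (fsfun_dflt vp) sumr_ge0.
by rewrite (big_fsetD1 v)//= lerDl sumr_ge0.
Qed.

Lemma push_is_bary a w s p : is_bary K p -> 0 <= s <= 1 ->
  ((a `<=` finsupp p)%fset -> simplices K (w |` finsupp p)%fset) ->
  is_bary K (push a w s p).
Proof.
move=> pK s01 Kw; have [Kp p0 sum1] := pK.
have p1 v : p v <= 1 by exact: bary_le1.
case: (boolP (a `<=` finsupp p)%fset) => [ap|nap]; last first.
  by rewrite push_id// least_eq0// mulr0.
have sum1' := sum_push a w s p; rewrite sum1 in sum1'.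
split => //; last exact: push_ge0.
apply: (simplex_face (Kw ap)) (finsupp_push ap).
apply/eqP => E; move: sum1'; rewrite E big_seq_fset0 => /eqP.
by rewrite eq_sym oner_eq0.
Qed.

Lemma continuous_coordinate (v : V) : continuous (fun x : X => val x v).
Proof.
apply/continuousP => U oU.
rewrite /open/= => s Ks; apply/open_closed_simplexP => p sp Up.
have /nbhs_ballP[e /= e0 eU] : nbhs (val p v) U by exact: open_nbhs_nbhs.
by exists e => // q sq pq; apply: eU; exact: pq.
Qed.

(** On a finite subcomplex the coherent topology is given by the coordinates.
    For each face s of S there is a radius e s that works for the points with
    support s: coherence provides it when x lies in s, and otherwise some
    nonzero coordinate of x vanishes on all of s.  The minimum of these radii
    works. *)
Lemma nbhs_finite_subcomplex (x : X) (S : {fset V}) (W : set X) :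
  nbhs x W -> (finsupp (val x) `<=` S)%fset ->
  exists2 e : R, 0 < e & forall y : X, (finsupp (val y) `<=` S)%fset ->
    (forall v, v \in S -> `|val x v - val y v| < e) -> W y.
Proof.
case=> U [oU Ux UW] xS.
have [e e0 eU] : {e : {fset V} -> R | forall s, 0 < e s &
    forall y : X, (finsupp (val y) `<=` S)%fset ->
    (forall v, v \in S -> `|val x v - val y v| < e (finsupp (val y))) -> U y}.
  suff /choice[e eP] : forall s, exists e : R, 0 < e /\ forall y : X,
      finsupp (val y) = s -> (s `<=` S)%fset ->
      (forall v, v \in S -> `|val x v - val y v| < e) -> U y.
    exists e => [s|y yS]; first by case: (eP s).
    by case: (eP (finsupp (val y))) => _ /(_ y erefl); apply.
  move=> s; case: (pselect (simplices K s)) => [Ks|nKs]; last first.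
    exists 1; split=> // y ys; case: nKs; rewrite -ys.
    by have /asboolP[] := valP y.
  case: (boolP (finsupp (val x) `<=` s)%fset) => [xs|/fsubsetPn[v vx vs]].
    have /open_closed_simplexP/(_ x xs Ux)[e e0 eU] := oU s Ks.
    exists e; split => // y ys sS xy; apply: eU => [|v].
      by rewrite /closed_simplex/= ys fsubset_refl.
    have [vS|vS] := boolP (v \in S); first exact: xy.
    rewrite /bary !fsfun_dflt ?subrr ?normr0//.
      by apply: contra vS; rewrite ys; exact: (fsubsetP sS).
    by apply: contra vS; exact: (fsubsetP xS).
  have xv0 : val x v != 0 by rewrite -mem_finsupp.
  exists `|val x v|; split; first by rewrite normr_gt0.
  move=> y ys sS /(_ v (fsubsetP xS v vx)).
  by rewrite (@fsfun_dflt _ _ _ (val y) v) ?ys// subr0 ltxx.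
exists (\big[Num.min/1]_(s <- fpowerset S) e s).
  by elim/big_ind: _ => // a b a0 b0; rewrite lt_min a0.
move=> y yS xy; apply/UW/eU => // v vS; apply: lt_le_trans (xy v vS) _.
by apply: ge_bigmin_seq => //; rewrite fpowersetE.
Qed.

End realization_topology.

Section schedule.
Context {R : realType}.
Implicit Types (t : R) (j k : nat).

(** The ramp from 0 to 1 between the times 1 / 2^(k+1) and 1 / 2^k. *)
Definition schedule k t : R := Num.max 0 (Num.min 1 (2 ^+ k.+1 * t - 1)).

Lemma schedule_01 k t : 0 <= schedule k t <= 1.
Proof. by rewrite /schedule le_max lexx ge_max ler01 ge_min lexx. Qed.

Lemma schedule_at0 k : schedule k 0 = 0.
Proof.
by rewrite /schedule mulr0 sub0r min_r ?max_l ?oppr_le0.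
Qed.

Lemma schedule_at1 k : schedule k 1 = 1.
Proof.
rewrite /schedule mulr1 min_l ?max_r// lerBrDr exprS.
by rewrite -[leLHS]mulr1 ler_pM// exprn_ege1// ler1n.
Qed.

(** Collapse j starts only once all collapses of larger index are complete. *)
Lemma schedule_lt1 j k t : (j < k)%N -> schedule k t < 1 -> schedule j t = 0.
Proof.
move=> jk; rewrite /schedule gt_max ltr01/= gt_min ltxx/= => kt.
apply/max_idPl; rewrite ge_min; apply/orP; right; rewrite subr_le0.
have [t0|/ltW t0] := leP 0 t; last first.
  by rewrite (le_trans _ ler01)// pmulr_rle0// exprn_gt0.
have jk' : 2 ^+ j.+1 * t <= 2 ^+ k * t by rewrite ler_wpM2r// ler_weXn2l// ler1n.
move: kt; rewrite exprS; lra.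
Qed.

Lemma continuous_schedule k : continuous (schedule k).
Proof.
move=> t.
apply: (@continuous_max _ _ (cst 0) (fun t => Num.min 1 (2 ^+ k.+1 * t - 1))).
  exact: cvg_cst.
apply: (@continuous_min _ _ (cst 1) (fun t => 2 ^+ k.+1 * t - 1)).
  exact: cvg_cst.
apply: continuousB; last exact: cvg_cst.
by apply: continuousM; [exact: cvg_cst|exact: cvg_id].
Qed.

End schedule.

(** * Infinite sequences of collapses *)

Section collapse.
Context {R : realType} {V : choiceType}.
Variables (K : simplicial_complex V) (face : nat -> {fset V}) (apex : nat -> V).
Implicit Types (s : {fset V}) (p : {fsfun V -> R with 0}) (t : R) (n : nat).
Local Notation X := (realization R K).

(** For a simplex s, this says that s survives all collapses of index at
    least n; an empty face stands for a void collapse. *)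
Definition avoids n s :=
  forall m, (n <= m)%N -> face m != fset0 -> ~~ (face m `<=` s)%fset.

Lemma avoidsS n s s' : (s' `<=` s)%fset -> avoids n s -> avoids n s'.
Proof.
by move=> ss' As m nm m0; apply: contra (As m nm m0) => /fsubset_trans; apply.
Qed.

(** The position at time t of a point that no collapse of index n or more
    affects.  The collapse of largest index is applied first. *)
Fixpoint flow t n p :=
  if n is k.+1 then flow t k (push (face k) (apex k) (schedule k t) p) else p.

Lemma flow0 n p : flow 0 n p = p.
Proof. by elim: n p => //= n IH p; rewrite schedule_at0 push_id ?mul0r. Qed.

Lemma flow_still t n p : (forall k, (k < n)%N -> schedule k t = 0) ->
  flow t n p = p.
Proof.
elim: n p => //= n IH p t0; rewrite t0// push_id ?mul0r// IH// => k kn.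
by apply: t0; exact: ltnW.
Qed.

(** The number of collapses taken into account does not matter once it is large
    enough; so one number serves for all the points of a finite subcomplex. *)
Lemma flow_avoids t n n' p : is_bary K p -> avoids n (finsupp p) ->
  (n <= n')%N -> flow t n' p = flow t n p.
Proof.
move=> [_ p0 _] An; elim: n' => [|n' IH]; first by rewrite leqn0 => /eqP ->.
rewrite leq_eqVlt => /predU1P[-> //|]; rewrite ltnS => nn'; rewrite -IH//=.
have [->|f0] := eqVneq (face n') fset0; first by rewrite push0.
by rewrite push_id// least_eq0// ?mulr0//; exact: An.
Qed.

Hypothesis apexN : forall n, apex n \notin face n.
(** Among the simplices left when collapse n takes place, those containing
    [face n] form a cone with apex [apex n]. *)
Hypothesis cone : forall n s, simplices K s -> face n != fset0 ->
  (face n `<=` s)%fset -> avoids n.+1 s ->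
  simplices K (apex n |` s)%fset /\ avoids n.+1 (apex n |` s)%fset.

Lemma push_stage n u p : is_bary K p -> avoids n.+1 (finsupp p) ->
  0 <= u <= 1 -> is_bary K (push (face n) (apex n) u p).
Proof.
move=> pK An u01; have [Kp _ _] := pK.
have [->|f0] := eqVneq (face n) fset0; first by rewrite push0.
by apply: push_is_bary => // fp; have [] := cone Kp f0 fp An.
Qed.

Lemma push_stage_avoids n p : is_bary K p -> avoids n.+1 (finsupp p) ->
  avoids n (finsupp (push (face n) (apex n) 1 p)).
Proof.
move=> pK An m; have [Kp p0 _] := pK.
have [E|fn0] := eqVneq (face n) fset0.
  rewrite E push0 leq_eqVlt => /predU1P[<-|]; last exact: An.
  by rewrite E eqxx.
have p1 v : p v <= 1 by exact: bary_le1 pK.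
rewrite leq_eqVlt => /predU1P[<-{m} f0|nm f0].
  have [v vf pv] := push1_eq0 f0 (apexN n) p1.
  apply/fsubsetPn; exists v => //; by rewrite memNfinsupp pv.
have [fp|nfp] := boolP (face n `<=` finsupp p)%fset; last first.
  by rewrite push_id ?least_eq0// ?mulr0//; exact: An.
have [_ Aw] := cone Kp fn0 fp An.
exact: (avoidsS (finsupp_push fp) Aw).
Qed.

(** If collapse n is complete then the point is ready for the smaller indices;
    if it is not, these have not started yet. *)
Lemma flow_is_bary t n p : is_bary K p -> avoids n (finsupp p) ->
  is_bary K (flow t n p).
Proof.
elim: n p => //= n IH p pK An.
have [t1|t1] := eqVneq (schedule n t) 1.
  by apply: IH; rewrite t1; [apply: push_stage => //; rewrite ler01 lexx|
                             exact: push_stage_avoids].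
rewrite flow_still; first exact: push_stage (schedule_01 _ _).
move=> k kn; apply: schedule_lt1 kn _; rewrite lt_neqAle t1.
by case/andP: (schedule_01 n t).
Qed.

Lemma flow1_avoids n p : is_bary K p -> avoids n (finsupp p) ->
  avoids 0 (finsupp (flow 1 n p)).
Proof.
elim: n p => //= n IH p pK An; rewrite schedule_at1.
apply: IH; last exact: push_stage_avoids.
by apply: push_stage => //; rewrite ler01 lexx.
Qed.

Lemma finsupp_flow t n p :
  (finsupp (flow t n p) `<=`
   finsupp p `|` \bigcup_(k <- iota 0 n) (apex k |` face k))%fset.
Proof.
elim: n p => [|n IH] p; first by rewrite fsubsetUl.
rewrite [flow _ _ _]/=; apply: fsubset_trans (IH _) _.
rewrite -(addn1 n) iotaD big_cat/= big_seq1 add0n.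
rewrite fsubUset; apply/andP; split; last first.
  by rewrite fsetUCA fsubsetUl.
apply: fsubset_trans (finsupp_push_sub _ _ _ _) _.
apply/fsubsetP => v; rewrite !inE => /orP[/orP[->//|->]|->]; rewrite ?orbT//.
Qed.

Lemma continuous_least (T : topologicalType) (a : {fset V}) (f : T -> V -> R) :
  (forall v, continuous (f^~ v)) -> continuous (fun z => least a (f z)).
Proof.
move=> cf; rewrite /least; elim: (enum_fset a) => [|v l IH].
  under eq_fun do rewrite big_nil; exact: cst_continuous.
under eq_fun do rewrite big_cons.
move=> z; apply: (@continuous_min _ _ (f^~ v)
  (fun z => \big[Num.min/1]_(u <- l) f z u)); [exact: cf|exact: IH].
Qed.

Lemma continuous_flow (T : topologicalType) (g : T -> {fsfun V -> R with 0})
    (c : T -> R) n v :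
  (forall u, continuous (fun z => g z u)) -> continuous c ->
  continuous (fun z => flow (c z) n (g z) v).
Proof.
move=> cg cc; elim: n g cg => [|n IH] g cg //=.
apply: IH => u; under eq_fun do rewrite pushE.
have cl : continuous (fun z => schedule n (c z) * least (face n) (g z)).
    move=> z; apply: cvgM; last exact: continuous_least.
  by apply: continuous_comp; [exact: cc|exact: continuous_schedule].
move=> z; apply: cvgD; last first.
  by apply: cvgM; [apply: cvgM; [exact: cl|exact: cvg_cst]|exact: cvg_cst].
by apply: cvgB; [exact: cg|apply: cvgM; [exact: cl|exact: cvg_cst]].
Qed.

(** The flow contracts the realization.  Continuity at a point x is checked in
    the open star of a vertex a of the support of x: by local finiteness all
    supports there lie in one finite set S, so that one number n of collapses
    serves the whole star and the flow is given there by finitely many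
    continuous coordinates. *)
Lemma collapsible_contractible (v0 : V) :
  (forall s, exists n, avoids n s) ->
  (forall v, exists S, forall s, simplices K s -> v \in s -> (s `<=` S)%fset) ->
  simplices K [fset v0]%fset ->
  (forall s, simplices K s -> avoids 0 s -> s = [fset v0]%fset) ->
  contractible R X.
Proof.
move=> /choice[stage stageP] locfin Kv0 bottom.
pose track (z : X * R) := flow z.2 (stage (finsupp (val z.1))) (val z.1).
have baryP (x : X) : is_bary K (val x) by have /asboolP := valP x.
have trackP z : `[< is_bary K (track z) >] by apply/asboolP/flow_is_bary.
pose H z : X := exist _ (track z) (trackP z).
pose x0 := [fsfun v in [fset v0]%fset => 1 : R | 0].
have x0E v : x0 v = (v == v0)%:R by rewrite fsfun_fun inE; case: ifP.
have x0supp : finsupp x0 = [fset v0]%fset.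
  by apply/fsetP => v; rewrite mem_finsupp x0E inE pnatr_eq0 eqb0 negbK.
have x0P : `[< is_bary K x0 >].
  apply/asboolP; split; first by rewrite x0supp.
    by move=> v; rewrite x0E.
  by rewrite x0supp big_seq_fset1 x0E eqxx.
exists (exist _ x0 x0P : X), H; split.
- apply: continuous_subspaceT => -[x t] W HW.
  have [Kx _ sumx] := baryP x.
  have /fset0Pn[a ax] := simplex_neq0 Kx.
  have [S SP] := locfin a.
  pose N := stage S.
  have xS : (finsupp (val x) `<=` S)%fset by exact: SP.
  have HE (y : X) u : (finsupp (val y) `<=` S)%fset ->
      val (H (y, u)) = flow u N (val y).
    move=> yS; rewrite /= /track/=.
    have [le|le] := leqP (stage (finsupp (val y))) N.
      by rewrite [RHS](flow_avoids u (baryP y) (stageP _) le).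
    exact: flow_avoids (baryP y) (avoidsS yS (stageP S)) (ltnW le).
  pose S' := (S `|` \bigcup_(k <- iota 0 N) (apex k |` face k))%fset.
  have HS' (y : X) u : (finsupp (val y) `<=` S)%fset ->
      (finsupp (val (H (y, u))) `<=` S')%fset.
    move=> yS; rewrite HE//; apply: fsubset_trans (finsupp_flow _ _ _) _.
    exact: fsetSU.
  have [e e0 eW] := @nbhs_finite_subcomplex R V K (H (x, t)) S' W HW (HS' x t xS).
  have near_S : \forall z \near (x, t : R), (finsupp (val z.1) `<=` S)%fset.
    have ca : continuous (fun z : X * R => val z.1 a).
      move=> z; apply: (@continuous_comp _ _ _ fst (fun y : X => val y a)).
        exact: cvg_fst.
      exact: continuous_coordinate.
    have : \forall z \near (x, t : R), val (z : X * R).1 a != 0.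
      apply: (ca (x, t) [set u | u != 0]%classic).
      apply: open_nbhs_nbhs; split; last by rewrite /= -mem_finsupp.
      exact: open_neq.
    apply: filterS => z za; apply: SP; first by have [] := baryP z.1.
    by rewrite mem_finsupp.
  have near_H : \forall z \near (x, t : R), forall v, v \in S' ->
      `|flow t N (val x) v - flow (z : X * R).2 N (val z.1) v| < e.
    suff : \forall z \near (x, t : R), forall v, [set` S']%classic v ->
      `|flow t N (val x) v - flow (z : X * R).2 N (val z.1) v| < e by [].
    apply: (filter_bigI) => v _.
    have cf : continuous (fun z : X * R => flow z.2 N (val z.1) v).
      apply: continuous_flow => [u z|z]; last exact: cvg_snd.
      apply: (@continuous_comp _ _ _ fst (fun y : X => val y u)).
        exact: cvg_fst.
      exact: continuous_coordinate.
    by have := cf (x, t); move=> /cvgrPdist_lt /(_ _ e0).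
  rewrite /=; apply: filterS2 near_S near_H => -[y u] /= yS yH.
  by apply: eW => [|v vS]; [exact: HS'|rewrite !HE//; exact: yH].
- by move=> x; apply/val_inj; rewrite /= /track flow0.
- move=> x; apply/val_inj => /=.
  have [Kt _ sumt] := asboolP _ (trackP (x, 1)).
  have := bottom _ Kt (flow1_avoids (baryP x) (stageP _)).
  rewrite -/(track (x, 1)) => E; apply/fsfunP => v; rewrite x0E.
  move: sumt; rewrite E big_seq_fset1; case: eqVneq => [->//|vv0] _.
  by rewrite fsfun_dflt// E inE.
Qed.

End collapse.

(** * An order on the lattice *)

(** The position of b in the enumeration 0, 1, -1, 2, -2, ... of the integers.
    All integers enumerated before b lie on one side of b. *)
Definition key (b : int) : nat := (`|b|.*2 - (0 < b)%R)%N.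

(** The direction from b towards 0; from 0 it points to the integers of larger
    key, so that a ray leaving 0 is made of later integers only. *)
Definition inward (b : int) : int := if 0 < b then -1 else 1.

Definition step (b : int) : int := if b == 0 then 0 else b + inward b.

Lemma key_inj : injective key.
Proof. by move=> a b; rewrite /key; case: (ltP 0 a); case: (ltP 0 b); lia. Qed.

Lemma key0 : key 0 = 0%N. Proof. by []. Qed.

Lemma key_eq0 b : (key b == 0%N) = (b == 0).
Proof. by rewrite -key0 (inj_eq key_inj). Qed.

Lemma key_step b : b != 0 -> (key (step b) < key b)%N.
Proof.
by rewrite /step /inward /key => /[dup] ? /negbTE ->; do 2 case: ltP; lia.
Qed.

Lemma step_neq b : b != 0 -> step b != b.
Proof. by rewrite /step /inward => /[dup] ? /negbTE ->; case: ltP; lia. Qed.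

Lemma key_step_le b : (key (step b) <= key b)%N.
Proof. by have [->//|b0] := eqVneq b 0; exact/ltnW/key_step. Qed.

Lemma dist_step_le a b : `|a - step b| <= `|a - b| + 1.
Proof. by rewrite /step /inward; case: (eqVneq b 0); case: (ltP 0 b); lia. Qed.

Lemma dist_step a b : (key a < key b)%N -> `|a - step b| = `|a - b| - 1.
Proof.
by rewrite /step /inward /key; case: (eqVneq b 0); case: (ltP 0 a); case: (ltP 0 b); lia.
Qed.

Lemma inward_ray a b : (key a < key b)%N -> a = b + inward b * `|a - b|.
Proof. by rewrite /inward /key; case: (ltP 0 a); case: (ltP 0 b); lia. Qed.

(** If b + inward b * d has no larger key than b, then an integer a either lies
    strictly inward of b, or has b between itself and that point. *)
Lemma dist_far a b (d : int) : 1 < d -> (key (b + inward b * d) <= key b)%N ->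
  `|a - step b| = `|a - b| - 1 \/ `|a - (b + inward b * d)| = `|a - b| + d.
Proof.
rewrite /step /inward /key.
by case: (eqVneq b 0); case: (ltP 0 b); case: (ltP 0 (_ + _)); lia.
Qed.

(** A power of 2 exceeds any sum of distinct smaller ones, so a sum of powers
    with decreasing exponents bounds another one only lexicographically. *)
Lemma dominant_powers (a b c a' b' c' : nat) : (c < b < a)%N ->
  (2 ^ a' + 2 ^ b' + 2 ^ c' <= 2 ^ a + 2 ^ b + 2 ^ c)%N ->
  (a' < a)%N \/ a' = a /\ ((b' < b)%N \/ b' = b /\ (c' <= c)%N).
Proof.
have dbl (i j : nat) : (i < j)%N -> (2 * 2 ^ i <= 2 ^ j)%N.
  by move=> ij; rewrite -expnS leq_exp2l.
have pos i : (0 < 2 ^ i)%N by rewrite expn_gt0.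
move=> /andP[/dbl cb /dbl ba] le.
have := pos a'; have := pos b'; have := pos c' => pc' pb' pa'.
case: (ltngtP a' a) => [|/dbl|a'a]; [by left|lia|right; split => //].
rewrite a'a in le.
case: (ltngtP b' b) => [|/dbl|b'b]; [by left|lia|right; split => //].
rewrite b'b in le.
by case: (leqP c' c) => // /dbl; lia.
Qed.

Section ordered_coordinates.
Implicit Types (u v : 'rV[int]_3) (x y z i : 'I_3).

Lemma sum_ord3 (M : nmodType) x y z (F : 'I_3 -> M) : uniq [:: x; y; z] ->
  \sum_i F i = F x + F y + F z.
Proof.
move=> U; rewrite (@perm_big _ _ _ _ _ [:: x; y; z]) /=.
  by rewrite !big_cons big_nil addr0 addrA.
apply: uniq_perm => //; first exact: index_enum_uniq.
move=> i; rewrite mem_index_enum; apply/esym; move: U.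
rewrite /= !inE -!val_eqE /=.
by have := ltn_ord i; have := ltn_ord x; have := ltn_ord y; have := ltn_ord z; lia.
Qed.

(** The residue mod 3 records the coordinate, which makes the three exponents
    of a point distinct and the weight injective. *)
Definition exponent v i : nat := (3 * key (v 0%R i) + i)%N.

Definition weight v : nat := (\sum_i 2 ^ exponent v i)%N.

Lemma exists_order v : exists o : 'I_3 * 'I_3 * 'I_3,
  uniq [:: o.1.1; o.1.2; o.2] &&
  (exponent v o.2 < exponent v o.1.2 < exponent v o.1.1)%N.
Proof.
pose o0 : 'I_3 := inord 0; pose o1 : 'I_3 := inord 1; pose o2 : 'I_3 := inord 2.
have e0 : o0 = 0%N :> nat by rewrite inordK.
have e1 : o1 = 1%N :> nat by rewrite inordK.
have e2 : o2 = 2%N :> nat by rewrite inordK.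
have n01 : exponent v o0 != exponent v o1 by rewrite /exponent e0 e1; lia.
have n02 : exponent v o0 != exponent v o2 by rewrite /exponent e0 e2; lia.
have n12 : exponent v o1 != exponent v o2 by rewrite /exponent e1 e2; lia.
have [h01|h01] := ltnP (exponent v o0) (exponent v o1);
have [h02|h02] := ltnP (exponent v o0) (exponent v o2);
have [h12|h12] := ltnP (exponent v o1) (exponent v o2); try lia;
[exists (o2, o1, o0)|exists (o1, o2, o0)|exists (o1, o0, o2)|
 exists (o2, o0, o1)|exists (o0, o2, o1)|exists (o0, o1, o2)];
rewrite /= !inE -!val_eqE/= e0 e1 e2/=; lia.
Qed.

(** The coordinates of v by decreasing exponent; they depend on v. *)
Definition order v := sval (cid (exists_order v)).
Definition hi v := (order v).1.1.
Definition mid v := (order v).1.2.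
Definition lo v := (order v).2.

Lemma orderP v : uniq [:: hi v; mid v; lo v].
Proof. by rewrite /hi/mid/lo/order; case: cid => /= o /andP[]. Qed.

Lemma mem_order v i : i \in [:: hi v; mid v; lo v].
Proof.
have := orderP v; rewrite /= !inE -!val_eqE /=.
have := ltn_ord i; have := ltn_ord (hi v); have := ltn_ord (mid v).
by have := ltn_ord (lo v); lia.
Qed.

Lemma order_exponent v :
  (exponent v (lo v) < exponent v (mid v) < exponent v (hi v))%N.
Proof. by rewrite /hi/mid/lo/order; case: cid => /= o /andP[]. Qed.

Lemma weightE u v : weight u =
  (2 ^ exponent u (hi v) + 2 ^ exponent u (mid v) + 2 ^ exponent u (lo v))%N.
Proof. exact: (sum_ord3 _ (orderP v)). Qed.

Lemma weight_lex u v : (weight u <= weight v)%N ->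
  (key (u 0%R (hi v)) < key (v 0%R (hi v)))%N \/
  u 0%R (hi v) = v 0%R (hi v) /\ ((key (u 0%R (mid v)) < key (v 0%R (mid v)))%N \/
    u 0%R (mid v) = v 0%R (mid v) /\ (key (u 0%R (lo v)) <= key (v 0%R (lo v)))%N).
Proof.
rewrite (weightE u v) (weightE v v) => /(dominant_powers (order_exponent v)).
rewrite /exponent => -[h|[h1 [h2|[h2 h3]]]].
- by left; lia.
- by right; split; [apply: key_inj; lia|left; lia].
- by right; split; [apply: key_inj; lia|right; split; [apply: key_inj; lia|lia]].
Qed.

(** A weight determines the sorted exponents, by [dominant_powers] in both
    directions; modulo 3 they give back the coordinates they belong to. *)
Lemma weight_inj : injective weight.
Proof.
move=> u v uv.
have E1 := dominant_powers (order_exponent v)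
  (a' := exponent u (hi u)) (b' := exponent u (mid u)) (c' := exponent u (lo u)).
have E2 := dominant_powers (order_exponent u)
  (a' := exponent v (hi v)) (b' := exponent v (mid v)) (c' := exponent v (lo v)).
move: E1 E2; rewrite -!weightE uv leqnn => /(_ isT) E1 /(_ isT) E2.
have [xx yy zz] : [/\ exponent u (hi u) = exponent v (hi v),
  exponent u (mid u) = exponent v (mid v) & exponent u (lo u) = exponent v (lo v)].
  by split; lia.
have same i j : exponent u i = exponent v j -> i = j /\ u 0%R i = v 0%R j.
  rewrite /exponent => E; have := ltn_ord i; have := ltn_ord j => ? ?.
  have ij : i = j by apply: val_inj => /=; lia.
  by split => //; apply: key_inj; rewrite ij in E *; lia.
have [hh uh] := same _ _ xx; have [hm um] := same _ _ yy; have [hl ul] := same _ _ zz.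
apply/rowP => i; have := mem_order v i.
rewrite !inE => /or3P[] /eqP->.
- by rewrite -{1}hh uh.
- by rewrite -{1}hm um.
- by rewrite -{1}hl ul.
Qed.

Lemma weight_lt u v :
  (forall i, (key (u 0%R i) <= key (v 0%R i))%N) ->
  (key (u 0%R (hi v)) < key (v 0%R (hi v)))%N -> (weight u < weight v)%N.
Proof.
move=> le lt; rewrite (weightE u v) (weightE v v).
have mono (i : 'I_3) : (2 ^ exponent u i <= 2 ^ exponent v i)%N.
  by rewrite leq_exp2l// /exponent leq_add2r leq_mul2l le.
have : (2 ^ exponent u (hi v) < 2 ^ exponent v (hi v))%N.
  by rewrite ltn_exp2l// /exponent ltn_add2r ltn_mul2l.
have := mono (mid v); have := mono (lo v); lia.
Qed.

Lemma weight0 v : (weight 0 <= weight v)%N.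
Proof.
by apply: leq_sum => i _; rewrite leq_exp2l// /exponent mxE key0 leq_add2r.
Qed.

Lemma hi_neq0 v : v != 0 -> v 0%R (hi v) != 0.
Proof.
apply: contraNneq => vh; apply/eqP/rowP => i; rewrite mxE; apply/eqP.
rewrite -key_eq0; have : (exponent v i <= exponent v (hi v))%N.
  have /andP[lm mh] := order_exponent v.
  by have := mem_order v i; rewrite !inE => /or3P[] /eqP ->; lia.
rewrite /exponent vh key0; move: (ltn_ord (hi v)) (key (v 0 i)) => hi3 k le.
by apply/eqP; lia.
Qed.
End ordered_coordinates.

(** * The collapses of the lattice *)

Section moves.
Implicit Types (u v p q : 'rV[int]_3) (d N : int).

Definition dist u v : int := \sum_i `|u 0 i - v 0 i|.

Lemma distE v p q : dist p q = `|p 0 (hi v) - q 0 (hi v)| +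
  `|p 0 (mid v) - q 0 (mid v)| + `|p 0 (lo v) - q 0 (lo v)|.
Proof. exact: (sum_ord3 _ (orderP v)). Qed.

Lemma distxx u : dist u u = 0.
Proof. by rewrite /dist big1// => i _; rewrite subrr normr0. Qed.

Lemma distC u v : dist u v = dist v u.
Proof. by apply: eq_bigr => i _; rewrite distrC. Qed.

Definition assemble v (a b c : int) : 'rV[int]_3 :=
  \row_i (if i == hi v then a else if i == mid v then b else c).

Lemma assemble_hi v a b c : assemble v a b c 0 (hi v) = a.
Proof. by rewrite mxE eqxx. Qed.

Lemma assemble_mid v a b c : assemble v a b c 0 (mid v) = b.
Proof.
have := orderP v; rewrite /= !inE mxE => /andP[/norP[/negbTE hm _] _].
by rewrite eq_sym hm eqxx.
Qed.

Lemma assemble_lo v a b c : assemble v a b c 0 (lo v) = c.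
Proof.
have := orderP v; rewrite /= !inE mxE andbT => /andP[/norP[_ hl] ml].
by rewrite !ifN// eq_sym.
Qed.

Definition assembleE := (assemble_hi, assemble_mid, assemble_lo).

Lemma eq_order u v p : u 0 (hi v) = p 0 (hi v) -> u 0 (mid v) = p 0 (mid v) ->
  u 0 (lo v) = p 0 (lo v) -> u = p.
Proof.
move=> h m l; apply/rowP => i.
by have := mem_order v i; rewrite !inE => /or3P[] /eqP ->.
Qed.

(** In coordinates centred at v and pointing inward: (0, 0, d). *)
Definition far d v := assemble v (v 0 (hi v)) (v 0 (mid v))
  (v 0 (lo v) + inward (v 0 (lo v)) * d).

(** In the same coordinates: (1, 0, 1), or (1, 0, 0) if v_lo = 0, from where
    there is no step inward. *)
Definition edge_apex v :=
  assemble v (step (v 0 (hi v))) (v 0 (mid v)) (step (v 0 (lo v))).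

(** In the same coordinates: (1, 1, 0); if v_mid = 0 there is no step
    inward in mid, and the step is made in lo. *)
Definition vertex_apex v := if v 0 (mid v) == 0 then edge_apex v
  else assemble v (step (v 0 (hi v))) (step (v 0 (mid v))) (v 0 (lo v)).

Lemma edge_apex_hi v : edge_apex v 0 (hi v) = step (v 0 (hi v)).
Proof. exact: assemble_hi. Qed.

Lemma vertex_apex_hi v : vertex_apex v 0 (hi v) = step (v 0 (hi v)).
Proof. by rewrite /vertex_apex; case: ifP => _; rewrite assemble_hi. Qed.

Lemma weight_edge_apex v : v != 0 -> (weight (edge_apex v) < weight v)%N.
Proof.
move=> v0; apply: weight_lt; last by rewrite edge_apex_hi key_step// hi_neq0.
move=> i; have := mem_order v i; rewrite !inE => /or3P[] /eqP ->;
by rewrite !assembleE// key_step_le.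
Qed.

Lemma weight_vertex_apex v : v != 0 -> (weight (vertex_apex v) < weight v)%N.
Proof.
move=> v0; apply: weight_lt; last by rewrite vertex_apex_hi key_step// hi_neq0.
rewrite /vertex_apex; case: ifP => _ i; have := mem_order v i;
by rewrite !inE => /or3P[] /eqP ->; rewrite !assembleE// key_step_le.
Qed.

(** Dominating the edge from v to [far d v].  If p is strictly inward in hi,
    the gain there pays for the step in lo.  Otherwise the step in lo gains 1,
    or the path from p to [far d v] runs through v in that coordinate, so that
    p is within 1 of v and within 3 of the apex. *)
Lemma edge_apex_close N d v p : 3 <= N -> N - 1 <= d <= N ->
  (weight p <= weight v)%N -> (weight (far d v) <= weight v)%N ->
  dist p v <= N -> dist p (far d v) <= N -> dist p (edge_apex v) <= N.
Proof.
move=> N3 dN /weight_lex pv /weight_lex; rewrite !(distE v) !assembleE.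
set a := v 0 (hi v) in pv *; set b := v 0 (mid v) in pv *.
set c := v 0 (lo v) in pv *.
set p1 := p 0 (hi v) in pv *; set p2 := p 0 (mid v) in pv *.
set p3 := p 0 (lo v) in pv *.
rewrite !ltnn; case=> [//|[_ [//|[_ cc]]]] dv df.
have := dist_step_le p1 a; have := dist_step_le p3 c => s3 s1.
case: pv => [/dist_step sa|[pa pv]]; first lia.
have d1 : 1 < d by lia.
case: (dist_far p3 d1 cc) => h; lia.
Qed.

(** Dominating v.  If v_mid = 0 no lighter point has the same hi coordinate as
    v and a different mid coordinate, and one steps in lo instead of mid.  If
    v_mid is not 0, the points in need of care are those on the inward lo ray
    from v, for which both steps lose 1: only those at distance N and N - 1 are
    too far away. *)
Lemma vertex_apex_close N v p : 3 <= N ->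
  (weight p <= weight v)%N -> p != far N v -> p != far (N - 1) v ->
  dist p v <= N -> dist p (vertex_apex v) <= N.
Proof.
move=> N3 /weight_lex pv pN pN1; rewrite /vertex_apex.
have eqf d : p 0 (hi v) = v 0 (hi v) -> p 0 (mid v) = v 0 (mid v) ->
    p 0 (lo v) = v 0 (lo v) + inward (v 0 (lo v)) * d -> p = far d v.
  by move=> ? ? ?; apply: (@eq_order _ v); rewrite !assembleE.
case: ifPn => m0; rewrite !(distE v) !assembleE.
  move/eqP: m0 => m0; rewrite m0 in pv *.
  case: pv => [/dist_step ->|[-> pv]].
    have := dist_step_le (p 0 (lo v)) (v 0 (lo v)); lia.
  have := dist_step_le (v 0 (hi v)) (v 0 (hi v)).
  case: pv => [|[-> le]]; first by rewrite key0; lia.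
  have [pc|pc] := eqVneq (p 0 (lo v)) (v 0 (lo v)).
    have := dist_step_le (v 0 (lo v)) (v 0 (lo v)); rewrite pc; lia.
  have lt : (key (p 0%R (lo v)) < key (v 0%R (lo v)))%N.
    by rewrite ltn_neqAle le andbT (inj_eq key_inj).
  have := dist_step lt; lia.
case: pv => [/dist_step ->|[pa pv]].
  have := dist_step_le (p 0 (mid v)) (v 0 (mid v)); lia.
have := dist_step_le (v 0 (hi v)) (v 0 (hi v)); rewrite pa.
case: pv => [/dist_step ->|[pb le]]; first lia.
have := dist_step_le (v 0 (mid v)) (v 0 (mid v)); rewrite pb.
have [->|pc] := eqVneq (p 0 (lo v)) (v 0 (lo v)); first lia.
have lt : (key (p 0%R (lo v)) < key (v 0%R (lo v)))%N.
  by rewrite ltn_neqAle le andbT (inj_eq key_inj).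
have ray := inward_ray lt.
suff : `|p 0 (lo v) - v 0 (lo v)| != N /\ `|p 0 (lo v) - v 0 (lo v)| != N - 1 by lia.
split; apply/eqP => E; rewrite E in ray.
  by move/eqP: pN; apply; apply: eqf.
by move/eqP: pN1; apply; apply: eqf.
Qed.

(** The vertex has the smallest index 0, as it is collapsed after the edges. *)
Definition move_face N v (j : nat) : {fset 'rV[int]_3} :=
  match j with
  | 0%N => [fset v] | 1%N => [fset v; far N v] | _ => [fset v; far (N - 1) v]
  end%fset.

Definition move_apex v (j : nat) := if j is 0%N then vertex_apex v else edge_apex v.

Lemma mem_move_face N v j : v \in move_face N v j.
Proof. by case: j => [|[|j]]; rewrite !inE eqxx. Qed.

Lemma move_face_hi N v j p : p \in move_face N v j -> p 0 (hi v) = v 0 (hi v).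
Proof.
case: j => [|[|j]]; rewrite !inE; first by move/eqP ->.
  by case/orP => /eqP ->; rewrite ?assembleE.
by case/orP => /eqP ->; rewrite ?assembleE.
Qed.

Lemma move_apex_hi v j : move_apex v j 0 (hi v) = step (v 0 (hi v)).
Proof. by case: j => [|j]; rewrite (vertex_apex_hi, edge_apex_hi). Qed.

Lemma weight_move_apex v j : v != 0 -> (weight (move_apex v j) < weight v)%N.
Proof.
by case: j => [|j]; [exact: weight_vertex_apex|exact: weight_edge_apex].
Qed.

Lemma move_apexN N v j k : v != 0 -> move_apex v j \notin move_face N v k.
Proof.
move=> v0; apply/negP => /move_face_hi; rewrite move_apex_hi => /eqP.
by apply/negP/step_neq/hi_neq0.
Qed.

(** The left inverse of [weight]; where no vertex has weight k the value 0 will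
    produce a void collapse. *)
Definition vertex_at (k : nat) : 'rV[int]_3 :=
  if pselect (exists v, weight v = k) is left h then sval (cid h) else 0.

Lemma vertex_at_weight v : vertex_at (weight v) = v.
Proof.
rewrite /vertex_at; case: pselect => [h|[]]; last by exists v.
by case: cid => /= u /weight_inj.
Qed.

(** The collapses at v have the indices 3 * weight v + j with j < 3.  The collapses at 0 are
    void, 0 being the vertex that remains. *)
Definition face N n : {fset 'rV[int]_3} :=
  let v := vertex_at (n %/ 3) in
  if v == 0 then fset0 else move_face N v (n %% 3).

Definition apex n :=
  let v := vertex_at (n %/ 3) in move_apex v (n %% 3).

Lemma faceE N v j : v != 0 -> (j < 3)%N ->
  face N (3 * weight v + j) = move_face N v j.
Proof.
move=> v0 j3; rewrite /face mulnC divnMDl// divn_small// addn0 vertex_at_weight.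
by rewrite (negbTE v0) modnMDl modn_small.
Qed.

Lemma apexE v j : (j < 3)%N -> apex (3 * weight v + j) = move_apex v j.
Proof.
move=> j3; rewrite /apex mulnC divnMDl// divn_small// addn0 vertex_at_weight.
by rewrite modnMDl modn_small.
Qed.

Lemma apexN N n : apex n \notin face N n.
Proof.
by rewrite /apex /face; case: eqVneq => [_|v0]; [rewrite inE|exact: move_apexN].
Qed.

Lemma face_inv N n : face N n != fset0 -> exists v j,
  [/\ v != 0, (j < 3)%N & n = (3 * weight v + j)%N].
Proof.
rewrite /face; case: ifPn => [_|v0 _]; first by rewrite eqxx.
exists (vertex_at (n %/ 3)), (n %% 3)%N; split; [by []|by rewrite ltn_mod|].
rewrite {1}(divn_eq n 3) mulnC; congr (3 * _ + _)%N.
by move: v0; rewrite /vertex_at; case: pselect => [h|]; [case: cid|rewrite eqxx].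
Qed.

End moves.

(** * The Rips complexes of the lattice *)

Section rips_lattice.
Context {R : realType} {r : R}.
Hypothesis r3 : 3 <= r.
Local Notation V := (Zd1 R 3).
Local Notation K := (Rips V r).
Local Notation N := (Num.floor r).

Lemma mdist_dist (u v : V) : mdist u v = (dist u v)%:~R.
Proof.
rewrite mdist_Zd1 /Zd1_dist /d1 /dist rmorph_sum/=.
by apply: eq_bigr => i _; rewrite !mxE -rmorphB/= intr_norm.
Qed.

Lemma rips_dist (s : {fset V}) : simplices K s <->
  s != fset0 /\ forall u v, u \in s -> v \in s -> dist u v <= N.
Proof.
have r0 : 0 <= r by apply: le_trans r3; rewrite ler0n.
split=> -[s0 sr]; split => //.
  move=> u v us vs; rewrite floor_ge_int -mdist_dist.
  by move/(diam_leP _ r0): sr; apply.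
by apply/(diam_leP _ r0) => u v us vs; rewrite mdist_dist -floor_ge_int sr.
Qed.

Lemma floor_ge3 : 3 <= N.
Proof. by rewrite floor_ge_int. Qed.

Lemma rips_cone (s : {fset V}) w : simplices K s ->
  (forall u, u \in s -> dist u w <= N) -> simplices K (w |` s)%fset.
Proof.
move=> /rips_dist[s0 sN] wN; apply/rips_dist; split.
  by apply/fset0Pn; exists w; rewrite !inE eqxx.
have N3 := floor_ge3.
move=> u v; rewrite !inE => /predU1P[->|us] /predU1P[->|vs].
- by rewrite distxx; lia.
- by rewrite distC wN.
- exact: wN.
- exact: sN.
Qed.

(** When the collapses at v take place, all heavier vertices are gone. *)
Lemma avoids_weight n (v : V) (s : {fset V}) : (n <= 3 * weight v + 2)%N ->
  avoids (face N) n.+1 s ->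
  forall p : V, p \in s -> (weight p <= weight v)%N.
Proof.
move=> nv As p ps; have [->|p0] := eqVneq p 0; first exact: weight0.
rewrite leqNgt; apply/negP => vp.
have /= Ap := As (3 * weight p + 0)%N; rewrite faceE// in Ap.
have /negP : ~~ ([fset p] `<=` s)%fset.
  by apply: Ap; [lia|apply/fset0Pn; exists p; rewrite inE].
by rewrite fsub1set.
Qed.

(** Adding the apex creates no simplex that was removed earlier: it is lighter
    than v, and differs from all vertices of the faces collapsed at v in the hi
    coordinate. *)
Lemma avoids_apex v j (s : {fset V}) : v != 0 -> (j < 3)%N ->
  avoids (face N) (3 * weight v + j).+1 s ->
  avoids (face N) (3 * weight v + j).+1 (move_apex v j |` s)%fset.
Proof.
move=> v0 j3 As m nm f0; have := As m nm f0.
have [u [k [u0 k3 E]]] := face_inv f0; rewrite E faceE//.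
apply: contra => sub; have wv := weight_move_apex j v0.
have us : u \in s.
  have := fsubsetP sub u (mem_move_face N u k); rewrite !inE => /predU1P[uw|//].
  by rewrite uw in E; lia.
have /weight_inj uv : weight u = weight v.
  have := avoids_weight (v := v) _ As us; lia.
apply/fsubsetP => p pf; have := fsubsetP sub p pf.
rewrite !inE => /predU1P[pw|//]; move: pf; rewrite pw uv => pf.
by have := move_apexN N j k v0; rewrite pf.
Qed.

Lemma faces_cone n (s : {fset V}) : simplices K s -> face N n != fset0 ->
  (face N n `<=` s)%fset -> avoids (face N) n.+1 s ->
  simplices K (apex n |` s)%fset /\ avoids (face N) n.+1 (apex n |` s)%fset.
Proof.
move=> Ks f0; have [v [j [v0 j3 ->]]] := face_inv f0; rewrite faceE// apexE//.
move=> fs As; split; last exact: avoids_apex.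
have N3 := floor_ge3.
have vs : v \in s by apply: (fsubsetP fs); exact: mem_move_face.
have [_ sN] := (rips_dist s).1 Ks.
have wle : forall q : V, q \in s -> (weight q <= weight v)%N.
  by apply: avoids_weight As; lia.
apply: rips_cone => // p ps.
have far_close d : N - 1 <= d <= N -> far d v \in s -> dist p (edge_apex v) <= N.
  move=> dN fars; apply: (edge_apex_close N3 dN (wle p ps) (wle _ fars)); exact: sN.
case: j j3 fs As far_close => [|[|[|//]]] _ fs As far_close /=.
(* Both edges at v are gone by now, so their ends are not in s. *)
- have nfar d : far d v \in s -> (d = N \/ d = N - 1) -> False.
    move=> fars dN; have [i [i0 i3 fi]] : exists i, [/\ (0 < i)%N, (i < 3)%N &
        move_face N v i = [fset v; far d v]%fset].
      by case: dN => ->; [exists 1%N|exists 2%N].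
    have := As (3 * weight v + i)%N; rewrite faceE// fi => Ai.
    have /negP : ~~ ([fset v; far d v] `<=` s)%fset.
      by apply: Ai; [lia|apply/fset0Pn; exists v; rewrite !inE eqxx].
    by apply; apply/fsubsetP => q; rewrite !inE => /orP[] /eqP ->.
  apply: (vertex_apex_close N3 (wle p ps)); last exact: sN.
    by apply: contraTneq ps => ->; apply/negP => /nfar; apply; left.
  by apply: contraTneq ps => ->; apply/negP => /nfar; apply; right.
- by apply: (far_close N); [lia|apply: (fsubsetP fs); rewrite !inE eqxx orbT].
- by apply: (far_close (N - 1)); [lia|apply: (fsubsetP fs); rewrite !inE eqxx orbT].
Qed.

Lemma avoids_eventually (s : {fset V}) : exists n, avoids (face N) n s.
Proof.
exists (\sum_(v <- s) (3 * weight v + 3))%N => m sm f0.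
have [v [j [v0 j3 E]]] := face_inv f0; apply/negP => fs.
have vs : v \in s.
  by apply: (fsubsetP fs); rewrite E faceE// mem_move_face.
by move: sm; rewrite (big_fsetD1 v)//= E; lia.
Qed.

Lemma avoids_all (s : {fset V}) : simplices K s -> avoids (face N) 0 s ->
  s = [fset 0]%fset.
Proof.
move=> Ks As; have sub : (s `<=` [fset 0])%fset.
  apply/fsubsetP => v vs; rewrite inE; apply/negP => /negP v0.
  have := As (3 * weight v + 0)%N isT; rewrite faceE// => Av.
  have /negP : ~~ ([fset v] `<=` s)%fset.
    by apply: Av; apply/fset0Pn; exists v; rewrite inE.
  by rewrite fsub1set.
apply/eqP; rewrite eqEfsubset sub fsub1set.
have /fset0Pn[v vs] := simplex_neq0 Ks.
by have := fsubsetP sub v vs; rewrite inE => /eqP <-.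
Qed.

Lemma rips_locally_finite (v : V) : exists S : {fset V},
  forall s, simplices K s -> v \in s -> (s `<=` S)%fset.
Proof.
pose B := (`|N| + `|N|).+1%N.
pose g (f : {ffun 'I_3 -> 'I_B}) : V := \row_i (v 0 i + (f i : nat)%:Z - N).
exists (seq_fset tt [seq g f | f : {ffun 'I_3 -> 'I_B}]) => s Ks vs.
have [_ sN] := (rips_dist s).1 Ks; have N3 := floor_ge3.
apply/fsubsetP => p ps; rewrite seq_fsetE; apply/mapP.
have close i : `|p 0 i - v 0 i| <= N.
  apply: le_trans (sN p v ps vs); rewrite /dist (bigD1 i)//= lerDl.
  by apply: sumr_ge0 => k _.
exists [ffun i => inord (absz (p 0 i - v 0 i + N))]; first by rewrite mem_enum.
apply/rowP => i; rewrite !mxE ffunE inordK; have := close i; rewrite /B; lia.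
Qed.

End rips_lattice.

Theorem theorem5p2 (R : realType) (r : R) (hr : 3 <= r) :
  contractible R (realization R (Rips (Zd1 R 3) r)).
Proof.
apply: (@collapsible_contractible _ _ _ (face (Num.floor r)) apex _ _ 0).
- exact: apexN.
- exact: faces_cone.
- exact: avoids_eventually.
- exact: rips_locally_finite.
- by apply: rips_vertex; apply: le_trans hr; rewrite ler0n.
- exact: avoids_all.
Qed.
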